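(* Let $M$ be a 7-dimensional manifold with a $G_2$ structure $\varphi$, let $\xi$ be a unit vector field on $M$, and let $(\phi,\xi,\eta,g)$ be the almost contact metric structure induced by $\varphi$ and $\xi$, with fundamental 2-form $\Phi$. Let $v=\sum_{i=1}^6 e_i\times\nabla_{e_i}\xi$, where $\{e_1,\dots,e_6,\xi\}$ is a local orthonormal frame. If $g(\xi,v)\neq 0$ (i.e. $g(\xi,v)$ is not identically zero), then $\nabla\Phi$ does not belong to any of the classes $\mathcal{D}_1,\mathcal{C}_5,\mathcal{C}_7,\mathcal{C}_8,\mathcal{C}_9,\mathcal{C}_{10},\mathcal{C}_{11},\mathcal{C}_{12}$.
   Context: **$G_2$ structures.** On $\mathbb{R}^7$ with dual basis $e^1,\dots,e^7$ put $\varphi_0=e^{123}+e^{145}+e^{167}+e^{246}-e^{257}-e^{347}-e^{356}$, where $e^{ijk}=e^i\wedge e^j\wedge e^k$. A $G_2$ structure on an oriented 7-manifold $M$ is a global 3-form $\varphi$ such that for each $p\in M$ there is a linear isomorphism $T_pM\cong\mathbb{R}^7$ carrying $\varphi_p$ to $\varphi_0$. It determines a Riemannian metric $g$ and an orientation (those of $\mathbb{R}^7$ under such isomorphisms) and a 2-fold vector cross product $\times$ defined by $\varphi(x,y,z)=g(x\times y,z)$. $\nabla$ is the Levi-Civita connection of $g$. **Induced almost contact metric structure.** For a unit vector field $\xi$ on $M$ put $\phi(x)=\xi\times x$, $\eta(x)=g(\xi,x)$. Then $(\phi,\xi,\eta,g)$ is an almost contact metric structure: $\phi^2=-I+\eta\otimes\xi$,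 $\eta(\xi)=1$, $g(\phi x,\phi y)=g(x,y)-\eta(x)\eta(y)$. Its fundamental 2-form is $\Phi(x,y)=g(x,\phi y)$, and $\nabla\Phi$ is regarded as the $(0,3)$-tensor $(x,y,z)\mapsto(\nabla_x\Phi)(y,z)$. The vector field $v$ does not depend on the choice of local orthonormal frame $\{e_1,\dots,e_6,\xi\}$. **Classes (Chinea–Gonzalez).** At each $p\in M$ let $\mathcal{C}$ be the space of trilinear forms $\alpha$ on $T_pM$ with $\alpha(x,y,z)=-\alpha(x,z,y)=-\alpha(x,\phi y,\phi z)+\eta(y)\alpha(x,\xi,z)+\eta(z)\alpha(x,y,\xi)$ for all $x,y,z$; then $(\nabla\Phi)_p\in\mathcal{C}$. Let $\{f_i\}$ be an orthonormal basis of $T_pM$. All identities below are for all $x,y,z\in T_pM$. - $\mathcal{D}_1=\{\alpha\in\mathcal{C}:\alpha(\xi,x,y)=\alpha(x,\xi,y)=0\}$. - $\mathcal{C}_5$: all $\alpha(x,y,z)=c\,(\Phi(x,z)\eta(y)-\Phi(x,y)\eta(z))$, $c\in\mathbb{R}$. - $\mathcal{C}_7,\dots,\mathcal{C}_{10}$: all $\alpha(x,y,z)=\eta(z)\beta(x,y)-\eta(y)\beta(x,z)$, where $\beta$ is a bilinear form with $\beta(\xi,\cdot)=\beta(\cdot,\xi)=0$ and, respectively: ($\mathcal{C}_7$) $\beta$ symmetric, $\beta(\phi x,\phi y)=\beta(x,y)$, $\sum_i\beta(f_i,f_i)=0$; ($\mathcal{C}_8$) $\beta$ antisymmetric, $\beta(\phi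 x,\phi y)=\beta(x,y)$, $\sum_i\beta(f_i,\phi f_i)=0$; ($\mathcal{C}_9$) $\beta$ symmetric, $\beta(\phi x,\phi y)=-\beta(x,y)$; ($\mathcal{C}_{10}$) $\beta$ antisymmetric, $\beta(\phi x,\phi y)=-\beta(x,y)$. - $\mathcal{C}_{11}=\{\alpha\in\mathcal{C}:\alpha(x,y,z)=-\eta(x)\alpha(\xi,\phi y,\phi z)\}$. - $\mathcal{C}_{12}=\{\alpha\in\mathcal{C}:\alpha(x,y,z)=\eta(x)\eta(y)\alpha(\xi,\xi,z)+\eta(x)\eta(z)\alpha(\xi,y,\xi)\}$. $\nabla\Phi$ belongs to the class given by one of these subspaces if $(\nabla\Phi)_p$ lies in that subspace for every $p\in M$. *)

(* Defs.v *)
From HB Require Import structures.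
From mathcomp Require Import all_boot all_order all_algebra.
From mathcomp Require Import all_classical all_reals all_analysis.

Set Implicit Arguments.
Unset Strict Implicit.
Unset Printing Implicit Defensive.

Import Order.TTheory GRing.Theory Num.Theory.
Import numFieldNormedType.Exports.

Local Open Scope classical_set_scope.
Local Open Scope ring_scope.

(* f is C^oo near u: on some neighbourhood of u, all iterated directional
   derivatives of f (including f itself) are Frechet differentiable. *)
Definition smooth_at (R : realType) (V W : normedModType R) (f : V -> W)
    (u : V) : Prop :=
  \forall u' \near u, forall vs : seq V,
    differentiable (foldr (fun v h => 'D_v h) f vs) u'.

(* coordV matters only on the open set coord @` dom, where it is the inverse
   of coord. *)
Record chart (R : realType) (n : nat) (M : topologicalType) := Chart {
  dom : set M;
  coord : M -> 'rV[R]_n;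
  coordV : 'rV[R]_n -> M;
  dom_open : open dom;
  cod_open : open (coord @` dom);
  coordK : {in dom, cancel coord coordV};
  coord_continuous : {in dom, continuous coord};
  coordV_continuous : {in coord @` dom, continuous coordV}
}.

(* The atlas is indexed by the points: chart_at p is a chosen chart around p. *)
Record manifold (R : realType) (n : nat) := Manifold {
  points :> topologicalType;
  points_hausdorff : hausdorff_space points;
  points_second_countable : @second_countable points;
  chart_at : points -> chart R n points;
  mem_chart_at : forall p, dom (chart_at p) p;
  chart_compatible : forall p q r,
    dom (chart_at p) r -> dom (chart_at q) r ->
    smooth_at (coord (chart_at q) \o coordV (chart_at p))
      (coord (chart_at p) r)
}.

Section Calculus.
Variables (R : realType) (n : nat) (M : manifold R n).
Implicit Types p q r : M.

(* T_p M is identified with R^n by means of the chart chart_at p; thus a vector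
   field is a function M -> 'rV_n and a covariant k-tensor field is a function
   M -> 'rV_n -> ... -> 'rV_n -> R.  Since neighbouring points use different
   charts, such data are differentiated after being read in a single chart. *)

(* components at r with respect to chart_at p |-> those w.r.t. chart_at q *)
Definition tcoord p q r : 'rV[R]_n -> 'rV[R]_n :=
  'd (coord (chart_at q) \o coordV (chart_at p)) (coord (chart_at p) r).

Definition base p : 'rV[R]_n := coord (chart_at p) p.

Definition fun_in_chart p (f : M -> R) : 'rV[R]_n -> R :=
  f \o coordV (chart_at p).

Definition field_in_chart p (X : M -> 'rV[R]_n) : 'rV[R]_n -> 'rV[R]_n :=
  fun u => let r := coordV (chart_at p) u in tcoord r p r (X r).

Definition smooth_fun_at p (f : M -> R) : Prop :=
  smooth_at (fun_in_chart p f) (base p).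

Definition smooth_field_at p (X : M -> 'rV[R]_n) : Prop :=
  smooth_at (field_in_chart p X) (base p).

Definition smooth_form3 (w : M -> 'rV[R]_n -> 'rV[R]_n -> 'rV[R]_n -> R) :
    Prop :=
  forall p x y z,
    smooth_at (fun u => let r := coordV (chart_at p) u in
      w r (tcoord p r r x) (tcoord p r r y) (tcoord p r r z)) (base p).

Definition deriv_along p (x : 'rV[R]_n) (f : M -> R) : R :=
  'D_x (fun_in_chart p f) (base p).

Definition lie_bracket (X Y : M -> 'rV[R]_n) p : 'rV[R]_n :=
  'D_(X p) (field_in_chart p Y) (base p)
  - 'D_(Y p) (field_in_chart p X) (base p).

(* nabla p x Y is the covariant derivative at p, in the direction x in T_p M,
   of a vector field Y that is smooth near p. *)
Definition affine_connection (nabla : forall p : M, 'rV[R]_n ->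
    (M -> 'rV[R]_n) -> 'rV[R]_n) : Prop :=
  forall p,
  [/\ forall Y, smooth_field_at p Y -> linear (fun x => nabla p x Y),
      forall x Y Z, smooth_field_at p Y -> smooth_field_at p Z ->
        nabla p x (fun q => Y q + Z q) = nabla p x Y + nabla p x Z
    & forall x f Y, smooth_fun_at p f -> smooth_field_at p Y ->
        nabla p x (fun q => f q *: Y q)
        = deriv_along p x f *: Y p + f p *: nabla p x Y].

Definition torsion_free (nabla : forall p : M, 'rV[R]_n ->
    (M -> 'rV[R]_n) -> 'rV[R]_n) : Prop :=
  forall p X Y, smooth_field_at p X -> smooth_field_at p Y ->
    nabla p (X p) Y - nabla p (Y p) X = lie_bracket X Y p.

Definition metric_connection (g : M -> 'rV[R]_n -> 'rV[R]_n -> R)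
    (nabla : forall p : M, 'rV[R]_n -> (M -> 'rV[R]_n) -> 'rV[R]_n) : Prop :=
  forall p x Y Z, smooth_field_at p Y -> smooth_field_at p Z ->
    deriv_along p x (fun q => g q (Y q) (Z q))
    = g p (nabla p x Y) (Z p) + g p (Y p) (nabla p x Z).

(* For a Riemannian metric g these conditions determine nabla on smooth fields
   by the Koszul formula; in particular nabla_X Y is then smooth. *)
Definition levi_civita (g : M -> 'rV[R]_n -> 'rV[R]_n -> R)
    (nabla : forall p : M, 'rV[R]_n -> (M -> 'rV[R]_n) -> 'rV[R]_n) : Prop :=
  [/\ affine_connection nabla, torsion_free nabla & metric_connection g nabla].

(* a = nabla w, i.e. a p x y z = (nabla_x w)(y, z), for a (0,2)-tensor w.  This
   determines a, as any tangent vectors at p extend to smooth fields near p. *)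
Definition covariant_derivative2
    (nabla : forall p : M, 'rV[R]_n -> (M -> 'rV[R]_n) -> 'rV[R]_n)
    (w : M -> 'rV[R]_n -> 'rV[R]_n -> R)
    (a : M -> 'rV[R]_n -> 'rV[R]_n -> 'rV[R]_n -> R) : Prop :=
  forall p x Y Z, smooth_field_at p Y -> smooth_field_at p Z ->
    a p x (Y p) (Z p)
    = deriv_along p x (fun q => w q (Y q) (Z q))
      - w p (nabla p x Y) (Z p) - w p (Y p) (nabla p x Z).

End Calculus.

Section G2.
Variable R : realType.
Local Notation E := 'rV[R]_7.

(* e^i (1 <= i <= 7) and e^i /\ e^j /\ e^k, with the determinant convention for
   the wedge product of 1-forms *)
Definition dual_basis (i : nat) (x : E) : R := x 0 (inord i.-1).

Definition wedge3 (i j k : nat) (x y z : E) : R :=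
  \det (\matrix_(a < 3, b < 3)
          dual_basis (nth 0%N [:: i; j; k] a) (nth 0 [:: x; y; z] b)).

Definition phi0 (x y z : E) : R :=
  wedge3 1 2 3 x y z + wedge3 1 4 5 x y z + wedge3 1 6 7 x y z
  + wedge3 2 4 6 x y z - wedge3 2 5 7 x y z - wedge3 3 4 7 x y z
  - wedge3 3 5 6 x y z.

Definition carries_to_phi0 (f : E -> E -> E -> R) (A : 'M[R]_7) : Prop :=
  A \in unitmx /\ forall x y z, f x y z = phi0 (x *m A) (y *m A) (z *m A).

Variable M : manifold R 7.

Definition G2_structure (phi : M -> E -> E -> E -> R) : Prop :=
  smooth_form3 phi /\ forall p, exists A, carries_to_phi0 (phi p) A.

(* Any two isomorphisms carrying phi p to phi0 differ by an element of G2,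
   which preserves the Euclidean inner product. *)
Definition G2_metric (phi : M -> E -> E -> E -> R) (g : M -> E -> E -> R) :
    Prop :=
  forall p A, carries_to_phi0 (phi p) A ->
    forall x y, g p x y = ((x *m A) *m (y *m A)^T) 0 0.

Definition G2_cross (phi : M -> E -> E -> E -> R) (g : M -> E -> E -> R)
    (cross : M -> E -> E -> E) : Prop :=
  forall p x y z, phi p x y z = g p (cross p x y) z.

Definition unit_vector_field (g : M -> E -> E -> R) (xi : M -> E) : Prop :=
  forall p, smooth_field_at p xi /\ g p (xi p) (xi p) = 1.

(* (e_1, ..., e_6, xi) is a smooth orthonormal frame near p *)
Definition local_orthonormal_frame (g : M -> E -> E -> R) (xi : M -> E)
    (p : M) (e : 'I_6 -> M -> E) : Prop :=
  (forall i, smooth_field_at p (e i)) /\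
  \forall q \near p,
    [/\ forall i j, g q (e i q) (e j q) = (i == j)%:R,
        forall i, g q (e i q) (xi q) = 0
      & g q (xi q) (xi q) = 1].

(* v is, near every point, given by the formula for some local orthonormal
   frame; the sum does not depend on the frame. *)
Definition frame_sum (g : M -> E -> E -> R) (cross : M -> E -> E -> E)
    (nabla : forall p : M, E -> (M -> E) -> E) (xi v : M -> E) : Prop :=
  forall p, exists2 e : 'I_6 -> M -> E, local_orthonormal_frame g xi p e &
    \forall q \near p,
      v q = \sum_(i < 6) cross q (e i q) (nabla q (e i q) xi).

Definition induced_endo (cross : M -> E -> E -> E) (xi : M -> E) :
    M -> E -> E :=
  fun p x => cross p (xi p) x.

Definition fundamental_form (g : M -> E -> E -> R) (J : M -> E -> E) :
    M -> E -> E -> R :=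
  fun p x y => g p x (J p y).

End G2.

(* The spaces of tensors of an almost contact metric structure (J, xi, eta, g)
   on a single tangent space E. *)
Section Classes.
Variable R : realType.
Local Notation E := 'rV[R]_7.
Variables (g : E -> E -> R) (J : E -> E) (xi : E).

Let eta (x : E) : R := g xi x.
Let Phi (x y : E) : R := g x (J y).

Definition orthonormal_basis (f : 'I_7 -> E) : Prop :=
  forall i j, g (f i) (f j) = (i == j)%:R.

Definition trilinear_form (a : E -> E -> E -> R) : Prop :=
  [/\ forall y z, scalar (fun x => a x y z),
      forall x z, scalar (fun y => a x y z)
    & forall x y, scalar (fun z => a x y z)].

Definition class_C (a : E -> E -> E -> R) : Prop :=
  trilinear_form a /\
  forall x y z,
    a x y z = - a x z y /\
    a x y z = - a x (J y) (J z) + eta y * a x xi z + eta z * a x y xi.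

Definition class_D1 (a : E -> E -> E -> R) : Prop :=
  class_C a /\ forall x y, a xi x y = 0 /\ a x xi y = 0.

Definition class_C5 (a : E -> E -> E -> R) : Prop :=
  exists c : R, forall x y z, a x y z = c * (Phi x z * eta y - Phi x y * eta z).

Definition vertical_ext (b : E -> E -> R) : E -> E -> E -> R :=
  fun x y z => eta z * b x y - eta y * b x z.

Definition class_of_bilinear (P : (E -> E -> R) -> Prop)
    (a : E -> E -> E -> R) : Prop :=
  exists b : {biscalar E},
    [/\ forall x, b xi x = 0 /\ b x xi = 0, P b
      & forall x y z, a x y z = vertical_ext b x y z].

Definition class_C7 : (E -> E -> E -> R) -> Prop :=
  class_of_bilinear (fun b =>
    [/\ forall x y, b x y = b y x,
        forall x y, b (J x) (J y) = b x y
      & forall f, orthonormal_basis f -> \sum_i b (f i) (f i) = 0]).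

Definition class_C8 : (E -> E -> E -> R) -> Prop :=
  class_of_bilinear (fun b =>
    [/\ forall x y, b x y = - b y x,
        forall x y, b (J x) (J y) = b x y
      & forall f, orthonormal_basis f -> \sum_i b (f i) (J (f i)) = 0]).

Definition class_C9 : (E -> E -> E -> R) -> Prop :=
  class_of_bilinear (fun b =>
    (forall x y, b x y = b y x) /\ forall x y, b (J x) (J y) = - b x y).

Definition class_C10 : (E -> E -> E -> R) -> Prop :=
  class_of_bilinear (fun b =>
    (forall x y, b x y = - b y x) /\ forall x y, b (J x) (J y) = - b x y).

Definition class_C11 (a : E -> E -> E -> R) : Prop :=
  class_C a /\ forall x y z, a x y z = - eta x * a xi (J y) (J z).

Definition class_C12 (a : E -> E -> E -> R) : Prop :=
  class_C a /\
  forall x y z,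
    a x y z = eta x * eta y * a xi xi z + eta x * eta z * a xi y xi.

End Classes.

Definition belongs_to (R : realType) (M : manifold R 7)
    (K : ('rV[R]_7 -> 'rV[R]_7 -> R) -> ('rV[R]_7 -> 'rV[R]_7) -> 'rV[R]_7 ->
         ('rV[R]_7 -> 'rV[R]_7 -> 'rV[R]_7 -> R) -> Prop)
    (g : M -> 'rV[R]_7 -> 'rV[R]_7 -> R) (J : M -> 'rV[R]_7 -> 'rV[R]_7)
    (xi : M -> 'rV[R]_7)
    (a : M -> 'rV[R]_7 -> 'rV[R]_7 -> 'rV[R]_7 -> R) : Prop :=
  forall p, K (g p) (J p) (xi p) (a p).

(* Main.v *)
Require Import Defs.
From mathcomp Require Import all_boot all_order all_algebra.
From mathcomp Require Import all_classical all_reals all_analysis.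
From mathcomp Require Import ring lra.

(** Write J for x |-> xi × x, the endomorphism of the almost contact structure.
    Since Phi(Y, xi) = g(Y, J xi) vanishes identically for every field Y, the
    Leibniz rule reduces (nabla_x Phi)(Y, xi) to - Phi(Y, nabla_x xi), which the
    skew symmetry of phi turns into g(xi, Y × nabla_x xi) (nablaPhi_xi).  Taking
    x = Y = e_i and summing over the frame gives

      g(xi, v) = sum_i (nabla Phi)(e_i, e_i, xi),

    a trace that depends only on the tensor (nabla Phi)_p.  So it is enough to
    see that this horizontal trace is zero on each of the eight subspaces of
    tensors, at a point where g(xi, v) does not vanish.

    In D_1, C_5, C_11 and C_12 every term of the trace is zero, because
    eta(e_i) = 0, Phi(e_i, e_i) = 0, or by the vanishing built into D_1.  In
    C_7, ..., C_10 the trace is the trace of the bilinear form beta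
    (trace_bilinear).  It is zero for skew beta (C_8 and C_10) and by definition
    for C_7.  For C_9, beta(J e_i, J e_i) = - beta(e_i, e_i) while
    (J e_1, ..., J e_6, xi) is again an orthonormal basis; as the trace of beta
    is the same in both bases (trace_basis_indep), it equals its opposite.  That
    J preserves orthonormality on the complement of xi is the one place where
    the special shape of phi0 matters: it rests on the vector cross product
    identity <x × y, x × z> = <x, x><y, z> - <x, y><x, z> (cross0_cross0). *)

Set Implicit Arguments.
Unset Strict Implicit.
Unset Printing Implicit Defensive.

Import Order.TTheory GRing.Theory Num.Theory.
Import numFieldNormedType.Exports.

Local Open Scope classical_set_scope.
Local Open Scope ring_scope.

(** * The standard cross product on R^7 *)

Section Model.
Variable R : realType.
Implicit Types x y z : 'rV[R]_7.

Definition dot x y : R := (x *m y^T) 0 0.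

(** The vector that represents the linear form phi0 x y, by its coordinates. *)
Definition cross0 x y : 'rV[R]_7 := \row_k phi0 x y (delta_mx 0 k).

Lemma sum7E (F : 'I_7 -> R) :
  \sum_i F i = F (inord 0) + F (inord 1) + F (inord 2) + F (inord 3)
               + F (inord 4) + F (inord 5) + F (inord 6).
Proof.
rewrite !big_ord_recr big_ord0 /= add0r.
by repeat (congr (_ + _)); congr F; apply/val_inj; rewrite /= inordK.
Qed.

Lemma dotE x y : dot x y = \sum_i x 0 i * y 0 i.
Proof. by rewrite /dot mxE; apply: eq_bigr => i _; rewrite mxE. Qed.

Lemma dotC x y : dot x y = dot y x.
Proof. by rewrite !dotE; apply: eq_bigr => i _; rewrite mulrC. Qed.

Lemma dot_deltar x k : dot x (delta_mx 0 k) = x 0 k.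
Proof. by rewrite /dot trmx_delta -colE mxE. Qed.

Lemma wedge3E i j k x y z :
  wedge3 i j k x y z =
    dual_basis i x
      * (dual_basis j y * dual_basis k z - dual_basis k y * dual_basis j z)
  - dual_basis i y
      * (dual_basis j x * dual_basis k z - dual_basis k x * dual_basis j z)
  + dual_basis i z
      * (dual_basis j x * dual_basis k y - dual_basis k x * dual_basis j y).
Proof.
rewrite /wedge3.
do 4 rewrite ?(expand_det_row _ ord0) ?big_ord_recl ?big_ord0 /cofactor.
by rewrite ?det_mx00 !mxE /=; ring.
Qed.

Lemma phi0_swap13 x y z : phi0 x y z = - phi0 z y x.
Proof. by rewrite /phi0 !wedge3E; ring. Qed.

Lemma dual_basis_delta i k : (0 < i <= 7)%N -> (k < 7)%N ->
  dual_basis i (delta_mx 0 (inord k) : 'rV[R]_7) = (i.-1 == k)%:R.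
Proof.
move=> /andP[i0 i7] k7; rewrite /dual_basis mxE eqxx /= -val_eqE /= !inordK //.
by rewrite prednK.
Qed.

Lemma dot_cross0 x y z : dot (cross0 x y) z = phi0 x y z.
Proof.
rewrite dotE sum7E !mxE /phi0 !wedge3E !dual_basis_delta //=.
by rewrite /dual_basis /=; ring.
Qed.

(** By polarization, equivalent to |x × y|^2 = |x|^2 |y|^2 - <x, y>^2.
    It fails for a general 3-form; for phi0 it is checked as a polynomial
    identity in the 21 coordinates. *)
Lemma cross0_cross0 x y z :
  dot (cross0 x y) (cross0 x z) = dot x x * dot y z - dot x y * dot x z.
Proof.
rewrite !dotE !sum7E !mxE /phi0 !wedge3E !dual_basis_delta //=.
by rewrite /dual_basis /=; ring.
Qed.

End Model.

(** * Traces of bilinear forms over orthonormal bases *)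

Section Trace.
Variable R : realType.
Local Notation E := 'rV[R]_7.

Lemma biscalarE (b : {biscalar E}) (x y : E) :
  b x y = \sum_i \sum_j x 0 i * y 0 j * b (delta_mx 0 i) (delta_mx 0 j).
Proof.
rewrite {1}(row_sum_delta x) linear_sumlz; apply: eq_bigr => i _.
rewrite linearZl_LR {1}(row_sum_delta y) linear_sumr mulr_sumr.
by apply: eq_bigr => j _; rewrite linearZr_LR /= mulrA.
Qed.

(** The inner product g has Gram matrix G = A A^T.  If the rows of K are a
    g-orthonormal basis then K G K^T = 1, hence K^T K = G^-1 does not depend on
    the basis, and the trace of b is its contraction with K^T K. *)
Lemma trace_basis_indep (A : 'M[R]_7) (g : E -> E -> R) (b : {biscalar E})
    (f h : 'I_7 -> E) :
  (forall x y, g x y = dot (x *m A) (y *m A)) ->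
  orthonormal_basis g f -> orthonormal_basis g h ->
  \sum_i b (f i) (f i) = \sum_i b (h i) (h i).
Proof.
move=> gE.
suff trE k : orthonormal_basis g k -> \sum_i b (k i) (k i) =
    \sum_i \sum_j invmx (A *m A^T) i j * b (delta_mx 0 i) (delta_mx 0 j).
  by move=> /trE -> /trE ->.
move=> onk; pose K : 'M[R]_7 := \matrix_i k i.
have rowK i : row i K = k i by rewrite rowK.
(* K G K^T = 1 says that G K^T is inverse to K, on either side. *)
have KG1 : A *m A^T *m (K^T *m K) = 1%:M.
  rewrite mulmxA; apply: mulmx1C; apply/matrixP => i j.
  rewrite [RHS]mxE -onk gE -!rowK -!row_mul !mulmxA -mulmxA -trmx_mul dotE mxE.
  by apply: eq_bigr => l _; rewrite !mxE.
have KK : K^T *m K = invmx (A *m A^T).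
  have [uG _] := mulmx1_unit KG1.
  by rewrite -[LHS](mulKmx uG) KG1 mulmx1.
under eq_bigr do rewrite biscalarE.
rewrite exchange_big; apply: eq_bigr => i _ /=.
rewrite exchange_big; apply: eq_bigr => j _ /=.
rewrite -mulr_suml -KK mxE; congr (_ * _); apply: eq_bigr => l _.
by rewrite !mxE.
Qed.

Lemma antisym_trace (b : E -> E -> R) (I : finType) (k : I -> E) :
  (forall x y, b x y = - b y x) -> \sum_i b (k i) (k i) = 0.
Proof.
by move=> bC; apply: big1 => i _; have := bC (k i) (k i); lra.
Qed.

End Trace.

(** * Frames adapted to a unit vector *)

Section Frames.
Variables (R : realType).
Local Notation E := 'rV[R]_7.
Implicit Types (xi : E) (k : 'I_6 -> E).

Definition extend_frame xi k (i : 'I_7) : E := oapp k xi (unlift ord0 i).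

Lemma sum_extend_frame xi k (F : E -> R) :
  \sum_i F (extend_frame xi k i) = F xi + \sum_i F (k i).
Proof.
rewrite big_ord_recl /extend_frame unlift_none /=; congr (_ + _).
by apply: eq_bigr => i _; rewrite liftK.
Qed.

Definition horizontal_trace xi k (a : E -> E -> E -> R) : R :=
  \sum_i a (k i) (k i) xi.

End Frames.

(** * The horizontal trace on the classes of tensors at a point *)

Section Pointwise.
Variables (R : realType).
Local Notation E := 'rV[R]_7.
Variables (f : E -> E -> E -> R) (A : 'M[R]_7) (g : E -> E -> R).
Variables (c : E -> E -> E).
Hypotheses (fA : carries_to_phi0 f A).
Hypothesis gA : forall x y, g x y = dot (x *m A) (y *m A).
Hypothesis fc : forall x y z, f x y z = g (c x y) z.

Lemma g_sym x y : g x y = g y x.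
Proof. by rewrite !gA dotC. Qed.

Lemma cross_mulmx x y : c x y *m A = cross0 (x *m A) (y *m A).
Proof.
have [uA fE] := fA; apply/rowP => k.
rewrite -[RHS]dot_deltar dot_cross0 -dot_deltar.
by rewrite -(mulmxKV uA (delta_mx 0 k)) -gA -fc fE.
Qed.

Lemma cross_swap x y z : g (c x y) z = - g (c z y) x.
Proof. by have [_ fE] := fA; rewrite -!fc !fE phi0_swap13. Qed.

Lemma cross_cyc x y z : g (c x y) z = g (c y z) x.
Proof.
by have [_ fE] := fA; rewrite -!fc !fE /phi0 !wedge3E; ring.
Qed.

(** For x of norm 1 this says that y |-> x × y is an isometry on the orthogonal
    complement of x. *)
Lemma cross_cross x y z : g (c x y) (c x z) = g x x * g y z - g x y * g x z.
Proof. by rewrite !gA !cross_mulmx cross0_cross0. Qed.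

Lemma cross_self x : c x x = 0.
Proof.
have [uA _] := fA; apply: (can_inj (mulmxK uA)).
rewrite cross_mulmx mul0mx; apply/rowP => k.
rewrite -[LHS]dot_deltar dot_cross0 mxE /phi0 !wedge3E; ring.
Qed.

Lemma cross_perp x y : g (c x y) y = 0.
Proof. by rewrite cross_cyc cross_self gA mul0mx /dot mul0mx mxE. Qed.

Variables (xi : E) (k : 'I_6 -> E).
Hypotheses (xi1 : g xi xi = 1) (kxi : forall i, g (k i) xi = 0).
Hypothesis onk : forall i j, g (k i) (k j) = (i == j)%:R.

Lemma orthonormal_extend_frame (h : 'I_6 -> E) :
  (forall i j, g (h i) (h j) = (i == j)%:R) -> (forall i, g (h i) xi = 0) ->
  orthonormal_basis g (extend_frame xi h).
Proof.
move=> onh hxi i j; rewrite /extend_frame.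
have hxi' l : g xi (h l) = 0 by rewrite g_sym.
by case: (unliftP ord0 i) => [i'|] ->; case: (unliftP ord0 j) => [j'|] -> /=;
  rewrite ?eqxx ?xi1 ?onh ?hxi ?hxi' ?(inj_eq lift_inj).
Qed.

Lemma orthonormal_cross :
  orthonormal_basis g (extend_frame xi (fun i => c xi (k i))).
Proof.
apply: orthonormal_extend_frame => [i j|i].
  by rewrite cross_cross xi1 onk g_sym kxi mul0r subr0 mul1r.
by rewrite cross_cyc cross_perp.
Qed.

Lemma trace_D1 a : class_D1 g (c xi) xi a -> horizontal_trace xi k a = 0.
Proof.
case=> -[_ aC] a0; apply: big1 => i _.
by have [-> _] := aC (k i) (k i) xi; have [_ ->] := a0 (k i) (k i);
  rewrite oppr0.
Qed.

Lemma trace_C5 a : class_C5 g (c xi) xi a -> horizontal_trace xi k a = 0.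
Proof.
case=> C aE; apply: big1 => i _.
by rewrite aE !(g_sym xi) kxi mulr0 sub0r g_sym cross_perp mul0r oppr0 mulr0.
Qed.

Lemma trace_C11 a : class_C11 g (c xi) xi a -> horizontal_trace xi k a = 0.
Proof.
by case=> _ aE; apply: big1 => i _; rewrite aE g_sym kxi oppr0 mul0r.
Qed.

Lemma trace_C12 a : class_C12 g (c xi) xi a -> horizontal_trace xi k a = 0.
Proof.
case=> _ aE; apply: big1 => i _.
by rewrite aE (g_sym xi (k i)) kxi !mul0r addr0.
Qed.

(** Reduces the classes C_7, ..., C_10 to the bilinear form itself: on
    (e_i, e_i, xi) the terms with eta(e_i) drop out and eta(xi) = 1.  Since
    b xi xi = 0, the remaining sum over the six e_i is also the full trace of b
    over an orthonormal basis. *)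
Lemma trace_bilinear P a : class_of_bilinear g xi P a ->
  exists2 b : {biscalar E}, P b &
    b xi xi = 0 /\ horizontal_trace xi k a = \sum_i b (k i) (k i).
Proof.
case=> b [b0 Pb aE]; exists b => //; split; first by have [] := b0 xi.
apply: eq_bigr => i _.
by rewrite aE /vertical_ext xi1 (g_sym xi) kxi mul1r mul0r subr0.
Qed.

Lemma trace_C7 a : class_C7 g (c xi) xi a -> horizontal_trace xi k a = 0.
Proof.
case/trace_bilinear=> b [_ _ b_tr] [b0 ->].
by have := b_tr _ (orthonormal_extend_frame onk kxi);
  rewrite (sum_extend_frame _ _ (fun x => b x x)) b0 add0r.
Qed.

Lemma trace_C8 a : class_C8 g (c xi) xi a -> horizontal_trace xi k a = 0.
Proof. by case/trace_bilinear=> b [bC _ _] [_ ->]; apply: antisym_trace. Qed.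

(** The frame J e_i computes the same trace of b as e_i, and its terms are the
    opposite ones. *)
Lemma trace_C9 a : class_C9 g (c xi) xi a -> horizontal_trace xi k a = 0.
Proof.
case/trace_bilinear=> b [_ bJ] [b0 ->].
have := trace_basis_indep b gA (orthonormal_extend_frame onk kxi)
  orthonormal_cross.
rewrite !(sum_extend_frame _ _ (fun x => b x x)) b0 !add0r.
under [in RHS]eq_bigr do rewrite bJ.
rewrite sumrN; lra.
Qed.

Lemma trace_C10 a : class_C10 g (c xi) xi a -> horizontal_trace xi k a = 0.
Proof. by case/trace_bilinear=> b [bC _] [_ ->]; apply: antisym_trace. Qed.

End Pointwise.

(** * The covariant derivative of the fundamental form *)

Section Manifold.
Variables (R : realType) (M : manifold R 7).
Local Notation E := 'rV[R]_7.
Variables (phi : M -> E -> E -> E -> R) (g : M -> E -> E -> R).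
Variables (cross : M -> E -> E -> E).
Variables (nabla : forall p : M, E -> (M -> E) -> E) (xi : M -> E).
Variable nablaPhi : M -> E -> E -> E -> R.
Hypotheses (hphi : G2_structure phi) (hg : G2_metric phi g).
Hypothesis hcross : G2_cross phi g cross.
Hypothesis hxi : unit_vector_field g xi.
Hypothesis hnablaPhi :
  covariant_derivative2 nabla
    (fundamental_form g (induced_endo cross xi)) nablaPhi.

Lemma Phi_xi p x : fundamental_form g (induced_endo cross xi) p x (xi p) = 0.
Proof.
have [_ /(_ p)[A fA]] := hphi; have gA := hg fA.
rewrite /fundamental_form /induced_endo (cross_self fA gA (hcross p)).
by rewrite (g_sym gA) gA !mul0mx mxE.
Qed.

(** Both Phi(Y, xi) and Phi(nabla_x Y, xi) vanish, so only - Phi(Y, nabla_x xi)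
    is left of the Leibniz formula.  Thus nabla Phi with last argument xi sees
    the derivative of xi only. *)
Lemma nablaPhi_xi p x Y : smooth_field_at p Y ->
  nablaPhi p x (Y p) (xi p) = g p (xi p) (cross p (Y p) (nabla p x xi)).
Proof.
move=> sY; have [_ /(_ p)[A fA]] := hphi; have gA := hg fA.
have [sxi _] := hxi p; rewrite hnablaPhi // Phi_xi subr0.
rewrite (_ : (fun q => _) = cst 0); last by apply/funext => q; exact: Phi_xi.
rewrite /deriv_along (_ : fun_in_chart p (cst 0) = cst 0) // derive_cst sub0r.
rewrite /fundamental_form /induced_endo (g_sym gA) (g_sym gA (xi p)).
by rewrite [RHS](cross_swap fA (hcross p)).
Qed.

End Manifold.

Theorem theorem4 (R : realType) (M : manifold R 7)
    (phi : M -> 'rV[R]_7 -> 'rV[R]_7 -> 'rV[R]_7 -> R)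
    (g : M -> 'rV[R]_7 -> 'rV[R]_7 -> R)
    (cross : M -> 'rV[R]_7 -> 'rV[R]_7 -> 'rV[R]_7)
    (nabla : forall p : M, 'rV[R]_7 -> (M -> 'rV[R]_7) -> 'rV[R]_7)
    (xi : M -> 'rV[R]_7)
    (J : M -> 'rV[R]_7 -> 'rV[R]_7)
    (Phi : M -> 'rV[R]_7 -> 'rV[R]_7 -> R)
    (nablaPhi : M -> 'rV[R]_7 -> 'rV[R]_7 -> 'rV[R]_7 -> R)
    (v : M -> 'rV[R]_7)
    (hphi : G2_structure phi)
    (hg : G2_metric phi g)
    (hcross : G2_cross phi g cross)
    (hnabla : levi_civita g nabla)
    (hxi : unit_vector_field g xi)
    (hJ : J = induced_endo cross xi)
    (hPhi : Phi = fundamental_form g J)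
    (hnablaPhi : covariant_derivative2 nabla Phi nablaPhi)
    (hv : frame_sum g cross nabla xi v)
    (hgv : ~ (forall p : M, g p (xi p) (v p) = 0)) :
  ~ belongs_to (@class_D1 R) g J xi nablaPhi /\
  ~ belongs_to (@class_C5 R) g J xi nablaPhi /\
  ~ belongs_to (@class_C7 R) g J xi nablaPhi /\
  ~ belongs_to (@class_C8 R) g J xi nablaPhi /\
  ~ belongs_to (@class_C9 R) g J xi nablaPhi /\
  ~ belongs_to (@class_C10 R) g J xi nablaPhi /\
  ~ belongs_to (@class_C11 R) g J xi nablaPhi /\
  ~ belongs_to (@class_C12 R) g J xi nablaPhi.
Proof.
have [p /eqP v_p] : exists p, g p (xi p) (v p) <> 0 by apply/existsNP.
have [_ /(_ p)[A fA]] := hphi; have gA := hg p A fA; have fc := hcross p.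
have [k [sk /nbhs_singleton[onk kxi xi1]] /nbhs_singleton vE] := hv p.
have tr_ne0 : horizontal_trace (xi p) (k^~ p) (nablaPhi p) != 0.
  apply: contra_neq v_p => <-; rewrite vE /horizontal_trace.
  rewrite gA mulmx_suml /dot linear_sum mulmx_sumr summxE.
  apply: eq_bigr => i _; rewrite hPhi hJ in hnablaPhi.
  by rewrite (nablaPhi_xi hphi hg hcross hxi hnablaPhi) // gA.
have not_in K :
    (K (g p) (J p) (xi p) (nablaPhi p) ->
      horizontal_trace (xi p) (k^~ p) (nablaPhi p) = 0) ->
    ~ belongs_to K g J xi nablaPhi.
  by move=> trK /(_ p) /trK tr0; rewrite tr0 eqxx in tr_ne0.
have Jp : J p = cross p (xi p) by rewrite hJ.
do !split; apply: not_in; rewrite Jp.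
- exact: trace_D1.
- exact: (trace_C5 fA gA fc kxi).
- exact: (trace_C7 gA xi1 kxi onk).
- exact: (trace_C8 gA xi1 kxi).
- exact: (trace_C9 fA gA fc xi1 kxi onk).
- exact: (trace_C10 gA xi1 kxi).
- exact: (trace_C11 gA kxi).
- exact: (trace_C12 gA kxi).
Qed.
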